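(* Let $K$ be any field, let $S=K[x_1,\dots,x_n]$, and let $G$ be a finite simple graph on the vertex set $[n]$ with edge ideal $I=I(G)\subset S$. Write $t_i=t_i(S/I)$. Suppose $t_b\geq \left\lceil \frac{3b}{2}\right\rceil$ for some integer $b\geq 0$ with $b\le \mathrm{pd}_S(S/I)$. Then for all integers $a\geq 0$ with $a+b\leq \mathrm{pd}_S(S/I)$, $$t_{a+b}\leq t_a+t_b.$$
   Context: $S=K[x_1,\dots,x_n]$ is standard graded ($\deg(x_i)=1$). For a finite simple graph $G$ on $[n]=\{1,\dots,n\}$ with edge set $E(G)$, the edge ideal is $I(G)=\langle x_ix_j : \{i,j\}\in E(G)\rangle\subset S$. The graded Betti numbers are $\beta_{i,j}(S/I)=\dim_K \mathrm{Tor}_i^S(S/I,K)_j$; $\mathrm{pd}_S(S/I)$ is the projective dimension of $S/I$; and for $0\le i\le \mathrm{pd}_S(S/I)$, $t_i(S/I)=\max\{j : \beta_{i,j}(S/I)\neq 0\}$ is the maximal shift in homological degree $i$ of the minimal graded free $S$-resolution of $S/I$. *)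

(* Defs.v *)
From mathcomp Require Import all_boot all_order all_algebra.
From mathcomp Require Import mpoly.

Set Implicit Arguments.
Unset Strict Implicit.
Unset Printing Implicit Defensive.

Import GRing.Theory.
Local Open Scope ring_scope.

Definition edge_ideal (K : fieldType) (n : nat) (G : rel 'I_n)
    (p : {mpoly K[n]}) : Prop :=
  exists c : 'I_n -> 'I_n -> {mpoly K[n]},
    p = \sum_(i < n) \sum_(j < n | G i j) c i j * ('X_i * 'X_j).
Arguments edge_ideal K {n} G p.

(* Exactness of ... -> P 1 -> P 0 -> S/I -> 0 for an ideal I of S. The
   augmentation P 0 -> S/I is given by a lift eps : P 0 -> S, which exists
   whenever P 0 is projective. *)
Definition resolves (S : comNzRingType) (I : S -> Prop) (P : nat -> lmodType S)
    (d : forall i, P i.+1 -> P i) (eps : P 0 -> S) : Prop :=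
  [/\ forall s : S, exists x, I (eps x - s),
      forall x, I (eps x) <-> exists y, d 0 y = x
    & forall i (x : P i.+1), d i x = 0 <-> exists y, d i.+1 y = x].

Definition projective (S : comNzRingType) (P : lmodType S) : Prop :=
  forall (M N : lmodType S) (f : {linear M -> N}) (g : {linear P -> N}),
    (forall y, exists x, f x = y) ->
    exists h : {linear P -> M}, forall x, f (h x) = g x.

Definition has_projective_resolution (S : comNzRingType) (I : S -> Prop)
    (l : nat) : Prop :=
  exists (P : nat -> lmodType S) (d : forall i, {linear P i.+1 -> P i})
         (eps : {linear P 0 -> S^o}),
    [/\ forall i, projective (P i),
        resolves I (fun i => d i) eps
      & forall i, (l < i)%N -> forall x : P i, x = 0].

(* b <= pd_S(S/I), where pd is the least length of a projective resolution. *)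
Definition le_pd (S : comNzRingType) (b : nat) (I : S -> Prop) : Prop :=
  forall l, has_projective_resolution I l -> (b <= l)%N.

(* F_i is the free module of row vectors of length rk i, whose k-th basis
   vector has degree shift i k; matrices act on the right. *)
Record graded_free_complex (K : fieldType) (n : nat) := GradedFreeComplex {
  rk : nat -> nat;
  shift : forall i, 'I_(rk i) -> nat;
  diff : forall i, 'M[{mpoly K[n]}]_(rk i.+1, rk i);
  aug : 'cV[{mpoly K[n]}]_(rk 0)
}.

(* p is homogeneous of degree d - e; in particular p = 0 when d < e. *)
Definition homog_from (K : fieldType) (n : nat) (e d : nat)
    (p : {mpoly K[n]}) : Prop :=
  forall m, m \in msupp p -> (mdeg m + e = d)%N.

Definition graded_free_resolution (K : fieldType) (n : nat)
    (I : {mpoly K[n]} -> Prop) (F : graded_free_complex K n) : Prop :=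
  [/\ forall i k l, homog_from (shift l) (shift k) (diff F i k l),
      forall k, homog_from 0 (shift k) (aug F k 0)
    & @resolves {mpoly K[n]} I (fun i => 'rV[{mpoly K[n]}]_(rk F i))
        (fun i v => v *m diff F i) (fun v => (v *m aug F) 0 0)].

Section Tor.
Variables (K : fieldType) (n : nat) (F : graded_free_complex K n).

(* The differential of F (x)_S K, with K = S/(x_1, ..., x_n). *)
Definition diffK (i : nat) : 'M[K]_(rk F i.+1, rk F i) :=
  map_mx (mcoeff 0%MM) (diff F i).

(* The row space of this matrix is (F_i (x)_S K)_j. *)
Definition chainsK (i j : nat) : 'M[K]_(rk F i) :=
  diag_mx (\row_(k < rk F i) (shift k == j)%:R).

Definition cyclesK (i j : nat) : 'M[K]_(rk F i) :=
  match i with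
  | 0 => chainsK 0 j
  | i'.+1 => (chainsK i'.+1 j :&: kermx (diffK i'))%MS
  end.

Definition boundariesK (i j : nat) : 'M[K]_(rk F i.+1, rk F i) :=
  chainsK i.+1 j *m diffK i.

(* When F is a graded free resolution of S/I, this is
   dim_K Tor_i^S(S/I, K)_j = dim_K H_i(F (x)_S K)_j. *)
Definition betti (i j : nat) : nat :=
  (\rank (cyclesK i j) - \rank (boundariesK i j))%N.

(* max {j | betti i j != 0}: betti i j vanishes unless j is a shift of F_i. The
   value is 0 when the set is empty, that is, for i > pd. *)
Definition max_shift (i : nat) : nat :=
  \max_(k < rk F i | betti i (shift k) != 0) shift k.

End Tor.

(* Main.v *)
Require Import Defs.
From mathcomp Require Import all_boot all_order all_algebra.
From mathcomp Require Import mpoly.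
From mathcomp Require Import zify ring.
From Stdlib Require Import Classical.

(** By Hochster's formula, the Betti number of S/I of index i and degree j is
    nonzero if and only if some set T of j vertices is such that the independence
    complex of the graph induced on T has nonzero reduced cohomology in dimension
    j - i - 1 (betti_hochster). So the theorem is about how that cohomology
    behaves when vertices are removed.

    Let v be a vertex of T and R a set of r neighbours of v in T. The long exact
    sequences of the deletion and the link of v for T and for T minus R share the
    same link term, because the link of v only involves non-neighbours of v.
    Hence nonzero cohomology on T forces nonzero cohomology on T minus v, on T
    minus R, or, one dimension lower, on T minus R and v (not_acyclic_step). In
    terms of (index, degree), one passes from (i, j) to (i - 1, j - 1),
    (i - r, j - r) or (i - r, j - r - 1).
    - A vertex without neighbours in T would make the complex a cone, so r = 1 is
      always possible: lowering the index by one costs at most two degrees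
      (hochster_pred).
    - If some vertex has two neighbours in T, then r = 2 lowers the index by two
      at the cost of at most three degrees, or by one at the cost of one degree
      (hochster_pred2).
    - Otherwise T spans an induced matching of i edges, and then (a, 2a) occurs
      for every a <= i (hochster_matching).
    Descend from index a + b and degree t_(a+b) to index a. If a matching is met
    on the way, then t_a >= 2a, while descending from a + b to b one index at a
    time gives t_(a+b) <= 2a + t_b. If none is met, the descent costs at most
    3b/2 degrees, rounded up, so t_(a+b) <= t_a + t_b by the hypothesis on t_b.

    The resolution F need not be minimal or multigraded, so Hochster's formula is
    obtained by comparing F with the Koszul complex of S/I: a staircase in the
    double complex of F tensored with the Koszul complex relates the homology of
    F tensored with K to that of the Koszul complex of S/I (zigzag), and the
    latter splits into strands by multidegree. Strands of non-squarefree
    multidegree are contractible, and those of squarefree multidegree are the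
    cochain complexes of the independence complexes above. *)


Set Implicit Arguments.
Unset Strict Implicit.
Unset Printing Implicit Defensive.

Import GRing.Theory.
Local Open Scope ring_scope.

(** * Signs *)

Section Signs.
Variable n : nat.
Implicit Types (v w : 'I_n) (A B : {set 'I_n}).

Definition inv_parity v A : bool := odd #|[set u in A | (u < v)%N]|.

Lemma inv_parityU1 v w A :
  w \notin A -> inv_parity v (w |: A) = (w < v)%N (+) inv_parity v A.
Proof.
move=> wA; rewrite /inv_parity.
case: (boolP (w < v)%N) => wv.
  have -> : [set u in w |: A | (u < v)%N] = w |: [set u in A | (u < v)%N].
    by apply/setP=> u; rewrite !inE; case: eqP => // ->; rewrite wv.
  by rewrite cardsU1 inE (negbTE wA) /= oddD.
rewrite addFb; congr (odd #|pred_of_set _|); apply/setP=> u; rewrite !inE.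
by case: eqP => // ->; rewrite (negbTE wv) !andbF.
Qed.

Lemma inv_parityD1 v B : inv_parity v (B :\ v) = inv_parity v B.
Proof.
rewrite /inv_parity; congr (odd #|pred_of_set _|); apply/setP=> u.
by rewrite !inE; case: eqP => // ->; rewrite ltnn !andbF.
Qed.

Lemma inv_parityU1_id v A : v \notin A -> inv_parity v (v |: A) = inv_parity v A.
Proof. by move=> vA; rewrite -inv_parityD1 setU1K. Qed.

(** The transposition of two new elements changes the sign; this is what makes
    every differential below square to zero. *)
Lemma inv_parity_swap v w A : v != w -> v \notin A -> w \notin A ->
  inv_parity v (w |: A) (+) inv_parity w A
    = ~~ (inv_parity w (v |: A) (+) inv_parity v A).
Proof.
move=> vw vA wA; rewrite !inv_parityU1 //.
have -> : (w < v)%N = ~~ (v < w)%N.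
  by rewrite -leqNgt ltn_neqAle eq_sym (inj_eq val_inj) vw.
by case: (_ < _)%N (inv_parity _ _) (inv_parity _ _) => -[] [].
Qed.

Lemma inv_parity_swapU v w A : v != w -> v \notin A -> w \notin A ->
  inv_parity v (w |: A) (+) inv_parity w (v |: A)
    = ~~ (inv_parity w A (+) inv_parity v A).
Proof.
move=> vw vA wA; have := inv_parity_swap vw vA wA.
by case: (inv_parity v _) (inv_parity w _) (inv_parity w _) (inv_parity v _)
  => -[] [] [].
Qed.

Lemma sum_antisymmetric (V : zmodType) (a : 'I_n -> 'I_n -> V) :
  (forall v, a v v = 0) -> (forall v w, v != w -> a v w = - a w v) ->
  \sum_v \sum_w a v w = 0.
Proof.
move=> a0 aN.
have -> : \sum_v \sum_w a v w =
    \sum_(v < n) \sum_(w < n) (if (v < w)%N then a v w else 0) +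
    \sum_(v < n) \sum_(w < n) (if (w < v)%N then a v w else 0).
  rewrite -big_split; apply: eq_bigr => v _; rewrite -big_split /=.
  apply: eq_bigr => w _; case: (ltngtP v w) => [||/val_inj ->];
    by rewrite ?addr0 ?add0r.
rewrite [X in _ + X]exchange_big -big_split big1 // => v _ /=.
rewrite -big_split big1 // => w _ /=.
case: ifP => [vw|_]; last by rewrite addr0.
by rewrite (aN v w) ?addNr //; apply: contraTneq vw => ->; rewrite ltnn.
Qed.

End Signs.

(** * Cohomology of independence complexes *)

Section Cochains.
Variables (K : fieldType) (n : nat).
Implicit Types (f g : {set 'I_n} -> K) (v w : 'I_n) (A B T : {set 'I_n}).

Definition coboundary f B : K :=
  \sum_(v in B) (-1) ^+ inv_parity v B * f (B :\ v).

Lemma coboundary_ext f g B :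
  (forall v, v \in B -> f (B :\ v) = g (B :\ v)) ->
  coboundary f B = coboundary g B.
Proof. by move=> fg; apply: eq_bigr => v vB; rewrite fg. Qed.

Lemma coboundaryD f g B :
  coboundary (fun A => f A + g A) B = coboundary f B + coboundary g B.
Proof. by rewrite -big_split; apply: eq_bigr => v _; rewrite mulrDr. Qed.

Lemma coboundaryB f g B :
  coboundary (fun A => f A - g A) B = coboundary f B - coboundary g B.
Proof. by rewrite -sumrB; apply: eq_bigr => v _; rewrite mulrBr. Qed.

(** The facets of a cone with apex v: its base, and the cones over the facets of
    the base. *)
Lemma coboundary_cone v f B : v \notin B ->
  coboundary f (v |: B) =
  (-1) ^+ inv_parity v B * f B +
  \sum_(u in B) (-1) ^+ inv_parity u (v |: B) * f (v |: (B :\ u)).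
Proof.
move=> vB; rewrite /coboundary big_setU1 //=; congr (_ + _).
  by rewrite -inv_parityD1 setU1K.
apply: eq_bigr => u uB; congr (_ * f _).
apply/setP=> x; rewrite !inE; case: (eqVneq x v) => [->|//].
by rewrite andbT; apply: contraNneq vB => ->.
Qed.

Lemma coboundary_coboundary f B : coboundary (coboundary f) B = 0.
Proof.
(* the two ways of removing v and w from B cancel each other *)
pose a v w := if [&& v \in B, w \in B & v != w] then
  (-1) ^+ (inv_parity v (B :\ v) (+) inv_parity w (B :\ v :\ w))
    * f (B :\ v :\ w) else 0.
rewrite -[RHS](@sum_antisymmetric n K a); last 2 first.
- by move=> v; rewrite /a eqxx !andbF.
- move=> v w vw; rewrite /a (eq_sym w v) andbCA; case: ifP => [|_]; last first.
    by rewrite oppr0.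
  case/and3P=> wB vB _.
  have eqB : B :\ v :\ w = B :\ w :\ v by rewrite setDDl setUC -setDDl.
  rewrite -eqB -mulNr; congr (_ * _).
  have hv : B :\ v = w |: (B :\ v :\ w) by rewrite setD1K // !inE eq_sym vw.
  have hw : B :\ w = v |: (B :\ v :\ w) by rewrite eqB setD1K // !inE vw.
  rewrite {1}hv hw inv_parity_swap ?inE ?eqxx ?andbF //.
  by rewrite signrN addbC // [in X in _ (+) X]inv_parityD1.
rewrite /coboundary [LHS]big_mkcond; apply: eq_bigr => v _.
case: ifP => [vB|vB]; last by rewrite big1 // => w _; rewrite /a vB.
rewrite big_distrr /= big_mkcond; apply: eq_bigr => w _.
rewrite /a vB /= !inE; case: (eqVneq w v) => [->|wv]; first by rewrite /= andbF.
rewrite /= andbT; case: ifP => // wB.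
by rewrite mulrA -signr_addb !inv_parityD1.
Qed.

Variable G : rel 'I_n.

Definition independent B := [forall u in B, forall w in B, ~~ G u w].

Definition nbr v T := [set u in T | G v u].

(** Vanishing of the reduced cohomology over K, in dimension e - 1, of the
    independence complex of the graph induced on T; the faces of cardinality e
    carry the cochains of that dimension. *)
Definition acyclic e T := forall f,
  (forall B, B \subset T -> independent B -> #|B| = e.+1 -> coboundary f B = 0) ->
  exists g, forall B, B \subset T -> independent B -> #|B| = e ->
    f B = coboundary g B.

Lemma independentP B :
  reflect {in B &, forall u w, ~~ G u w} (independent B).
Proof.
apply: (iffP forall_inP) => [h u w uB wB|h u uB].
  by move/forall_inP: (h u uB); apply.
by apply/forall_inP => w wB; apply: h.
Qed.

Lemma independentS A B : A \subset B -> independent B -> independent A.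
Proof.
move=> /subsetP AB /independentP h; apply/independentP => u w uA wA.
by apply: h; apply: AB.
Qed.

Hypotheses (G_sym : ssrbool.symmetric G) (G_irr : irreflexive G).

Lemma independentU1 v B T : v \notin B -> v \in T ->
  ((v |: B) \subset T) && independent (v |: B)
    = (B \subset (T :\ v) :\: nbr v T) && independent B.
Proof.
move=> vB vT; apply/andP/andP => -[sB iB].
  move: sB; rewrite subUset sub1set vT /= => sB; split; last first.
    exact: independentS (subsetUr _ _) iB.
  apply/subsetP=> u uB; rewrite !inE (subsetP sB) // andbT.
  have uv : u != v by apply: contraNneq vB => <-.
  by rewrite uv andbT /=; apply: (independentP _ iB); rewrite !inE ?eqxx ?uB ?orbT.
have hB u : u \in B -> [/\ ~~ G v u & u \in T].
  by move/(subsetP sB); rewrite !inE => /andP[]; case: (u \in T) => //; rewrite andbF.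
split.
  by rewrite subUset sub1set vT; apply/subsetP=> u /hB[].
apply/independentP => u w; rewrite !inE => /orP[/eqP->|uB] /orP[/eqP->|wB].
- by rewrite G_irr.
- by case: (hB w wB).
- by rewrite G_sym; case: (hB u uB).
- exact: (independentP _ iB).
Qed.

Let sub_setD1 v B T : v \notin B -> B \subset T -> B \subset T :\ v.
Proof.
move=> vB sB; apply/subsetP=> u uB; rewrite !inE (subsetP sB) // andbT.
by apply: contraNneq vB => <-.
Qed.

Lemma inv_parity_cone v u B : v \notin B -> u \in B ->
  inv_parity u (v |: B) (+) inv_parity v (B :\ u)
    = ~~ (inv_parity v B (+) inv_parity u B).
Proof.
move=> vB uB.
have vu : v != u by apply: contraNneq vB => ->.
have h := @inv_parity_swap n u v (B :\ u).
rewrite -(inv_parityD1 u (v |: B)).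
have -> : (v |: B) :\ u = v |: (B :\ u).
  apply/setP=> x; rewrite !inE; case: (eqVneq x v) => [->|//].
  by rewrite vu.
by rewrite h ?setD1K ?inE ?eqxx // 1?eq_sym // ?negb_and ?vB ?orbT // inv_parityD1.
Qed.

Lemma coboundary_conepart v (h : {set 'I_n} -> K) B : v \notin B ->
  \sum_(u in B) (-1) ^+ inv_parity u (v |: B) *
     ((-1) ^+ inv_parity v (B :\ u) * h (B :\ u))
  = - ((-1) ^+ inv_parity v B * coboundary h B).
Proof.
move=> vB; rewrite mulr_sumr -sumrN; apply: eq_bigr => u uB.
by rewrite !mulrA -!signr_addb inv_parity_cone // signrN mulNr.
Qed.

Let setU1_split v B : v \in B -> exists2 B' : {set 'I_n}, v \notin B' & B = v |: B'.
Proof. by move=> vB; exists (B :\ v); rewrite ?setD1K // !inE eqxx. Qed.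

(** Exactness of the sequence of the link and the deletion of v, at the cohomology
    of T: a cocycle that restricts to a coboundary on the deletion of v may be
    assumed to vanish there, and is then a cocycle of the link. *)
Lemma acyclic_del_link v e T : v \in T -> acyclic e (T :\ v) ->
  (forall e', e = e'.+1 -> acyclic e' ((T :\ v) :\: nbr v T)) -> acyclic e T.
Proof.
move=> vT acD acL f fZ.
have [g0 g0E] : exists g, forall B, B \subset T :\ v -> independent B ->
    #|B| = e -> f B = coboundary g B.
  by apply: acD => B sB; apply: fZ; apply: subset_trans sB (subsetDl _ _).
pose f1 B := f B - coboundary g0 B.
have f1Z B : B \subset T -> independent B -> #|B| = e.+1 -> coboundary f1 B = 0.
  by move=> sB iB cB; rewrite coboundaryB fZ // coboundary_coboundary subrr.
have f10 B : v \notin B -> B \subset T -> independent B -> #|B| = e -> f1 B = 0.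
  by move=> vB sB iB cB; rewrite /f1 g0E ?subrr //; apply: sub_setD1.
suff [g gE] : exists g, forall B, B \subset T -> independent B -> #|B| = e ->
    f1 B = coboundary g B.
  exists (fun B => g B + g0 B) => B sB iB cB.
  by rewrite coboundaryD -gE // /f1 subrK.
case: e => [|e] in acD acL fZ g0E f1Z f10 *.
  exists (fun=> 0) => B sB iB cB.
  have B0 : B = set0 by apply/eqP; rewrite -cards_eq0 cB.
  by rewrite f10 // ?B0 ?inE // /coboundary big_set0.
have [|g gE] := acL e erefl (fun B => (-1) ^+ inv_parity v B * f1 (v |: B)).
  move=> B sB iB cB.
  have vB : v \notin B.
    by apply: contraTN sB => vB; apply/subsetPn; exists v; rewrite // !inE eqxx andbF.
  have /andP[sB' iB'] : ((v |: B) \subset T) && independent (v |: B).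
    by rewrite independentU1 // sB.
  have cB' : #|v |: B| = e.+2 by rewrite cardsU1 vB cB.
  have := f1Z _ sB' iB' cB'.
  rewrite coboundary_cone // f10 //; last by apply: subset_trans sB' ; apply: subsetUr.
  rewrite mulr0 add0r => h.
  apply: (can_inj (signrMK (inv_parity v B))); rewrite mulr0.
  apply/eqP; rewrite -oppr_eq0 -coboundary_conepart //; apply/eqP; rewrite -[RHS]h.
  by apply: eq_bigr => u uB; rewrite signrMK.
exists (fun B => if v \in B then - ((-1) ^+ inv_parity v B * g (B :\ v)) else 0).
move=> B sB iB cB; case: (boolP (v \in B)) => vB; last first.
  rewrite f10 // /coboundary big1 // => u uB.
  by rewrite !inE (negbTE vB) andbF mulr0.
have [B' vB' eB] := setU1_split vB; rewrite eB in sB iB cB *.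
rewrite coboundary_cone // (negbTE vB') mulr0 add0r.
have eL : coboundary g B' = (-1) ^+ inv_parity v B' * f1 (v |: B').
  rewrite -gE //; first 2 last.
  - by move: cB; rewrite cardsU1 vB' => -[].
  - by have := independentU1 vB' vT; rewrite sB iB => /esym/andP[].
  - by have := independentU1 vB' vT; rewrite sB iB => /esym/andP[].
transitivity (- \sum_(u in B') (-1) ^+ inv_parity u (v |: B') *
     ((-1) ^+ inv_parity v (B' :\ u) * g (B' :\ u))).
  by rewrite coboundary_conepart // opprK eL signrMK.
rewrite -sumrN; apply: eq_bigr => u uB.
have vBu : v \notin B' :\ u by rewrite !inE negb_and vB' orbT.
by rewrite setU11 -(inv_parityD1 v (v |: _)) setU1K // mulrN.
Qed.

(** Exactness of the same sequence at the cohomology of the link: a cocycle of the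
    link is extended by zero to a cocycle of T, and a primitive of the extension
    is, outside the star of v, a cocycle of the deletion. *)
Lemma acyclic_link v e T : v \in T -> acyclic e (T :\ v) -> acyclic e.+1 T ->
  acyclic e ((T :\ v) :\: nbr v T).
Proof.
move=> vT acD acT f fZ.
pose F B := if v \in B then (-1) ^+ inv_parity v B * f (B :\ v) else 0.
have FE B : v \notin B -> F (v |: B) = (-1) ^+ inv_parity v B * f B.
  by move=> vB; rewrite /F setU11 -inv_parityD1 setU1K.
have cF B : v \notin B ->
    coboundary F (v |: B) = - ((-1) ^+ inv_parity v B * coboundary f B).
  move=> vB; rewrite coboundary_cone // {1}/F (negbTE vB) mulr0 add0r.
  rewrite -coboundary_conepart //; apply: eq_bigr => u uB.
  by rewrite FE // !inE negb_and vB orbT.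
have [|H HE] := acT F.
  move=> B sB iB cB; case: (boolP (v \in B)) => vB; last first.
    rewrite /coboundary big1 // => u uB.
    by rewrite /F !inE (negbTE vB) andbF mulr0.
  have [B' vB' eB] := setU1_split vB; rewrite eB in sB iB cB *.
  move: (independentU1 vB' vT); rewrite sB iB => /esym/andP[sB' iB'].
  rewrite cF // fZ // ?mulr0 ?oppr0 //.
  by move: cB; rewrite cardsU1 vB' => -[].
have [|h hE] := acD H.
  move=> B sB iB cB; rewrite -HE //; last by apply: subset_trans sB (subsetDl _ _).
  by rewrite /F; case: ifP => // vB; move/subsetP/(_ _ vB): sB; rewrite !inE eqxx.
pose g' B := (-1) ^+ inv_parity v B * H (v |: B).
exists (fun B => h B - g' B) => B sB iB cB.
have vB : v \notin B.
  by apply: contraTN sB => vB; apply/subsetPn; exists v; rewrite // !inE eqxx andbF.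
have /andP[sB' iB'] : ((v |: B) \subset T) && independent (v |: B).
  by rewrite independentU1 // sB.
have := HE _ sB' iB'; rewrite cardsU1 vB cB FE // coboundary_cone // => /(_ erefl).
have -> : \sum_(u in B) (-1) ^+ inv_parity u (v |: B) * H (v |: B :\ u)
    = - ((-1) ^+ inv_parity v B * coboundary g' B).
  rewrite -coboundary_conepart //; apply: eq_bigr => u uB; rewrite signrMK //.
rewrite -mulrN -mulrDr => /(can_inj (signrMK _)) ->.
rewrite coboundaryB hE //; apply/subsetP=> u uB.
by move/subsetP/(_ _ uB): sB; rewrite inE => /andP[].
Qed.

(** The independence complex is then a cone with apex v. *)
Lemma acyclic_isolated v e T : v \in T -> (forall u, u \in T -> ~~ G v u) ->
  acyclic e T.
Proof.
move=> vT isoT f fZ.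
have indU B : v \notin B -> B \subset T -> independent B ->
    ((v |: B) \subset T) && independent (v |: B).
  move=> vB sB iB; rewrite independentU1 // iB andbT.
  apply/subsetP=> u uB; have uT := subsetP sB u uB.
  by rewrite !inE uT andbT /= isoT //=; apply: contraNneq vB => <-.
exists (fun B => if v \in B then 0 else (-1) ^+ inv_parity v B * f (v |: B)).
move=> B sB iB cB; case: (boolP (v \in B)) => vB.
  have [B' vB' eB] := setU1_split vB; rewrite eB coboundary_cone // (negbTE vB').
  rewrite big1 ?addr0 ?signrMK // => u uB.
  by rewrite setU11 mulr0.
have /andP[sB' iB'] := indU _ vB sB iB.
have := fZ _ sB' iB'; rewrite cardsU1 vB cB coboundary_cone // => /(_ erefl).
pose h A := (-1) ^+ inv_parity v A * f (v |: A).
have -> : \sum_(u in B) (-1) ^+ inv_parity u (v |: B) * f (v |: B :\ u)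
    = - ((-1) ^+ inv_parity v B * coboundary h B).
  by rewrite -coboundary_conepart //; apply: eq_bigr => u uB; rewrite signrMK.
rewrite -mulrN -mulrDr => /(canRL (signrMK _)); rewrite mulr0 => /subr0_eq ->.
by apply: coboundary_ext => u uB; rewrite !inE (negbTE vB) andbF.
Qed.

(** Removing R from T does not change the link of v, so the two exact sequences
    of the link and the deletion, for T and for T minus R, can be spliced. *)
Lemma not_acyclic_step v (R : {set 'I_n}) e T :
  v \in T -> R \subset nbr v T -> ~ acyclic e T ->
  [\/ ~ acyclic e (T :\ v), ~ acyclic e (T :\: R)
    | exists2 e', e = e'.+1 & ~ acyclic e' ((T :\: R) :\ v)].
Proof.
move=> vT sR nT.
case: (classic (acyclic e (T :\ v))) => [aD|]; last by constructor 1.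
case: (classic (acyclic e (T :\: R))) => [aR|]; last by constructor 2.
constructor 3; apply: NNPP => nL; apply: nT.
apply: (acyclic_del_link vT aD) => e' eE.
have vR : v \in T :\: R.
  rewrite inE vT andbT; apply/negP => /(subsetP sR).
  by rewrite inE G_irr andbF.
have -> : (T :\ v) :\: nbr v T = ((T :\: R) :\ v) :\: nbr v (T :\: R).
  apply/setP=> u; rewrite !inE.
  case: (boolP (u \in R)) => [/(subsetP sR)|_] /=; last by [].
  by rewrite inE => /andP[-> ->]; rewrite /= !andbF.
apply: acyclic_link => //; last by rewrite -eE.
by apply: NNPP => nR; apply: nL; exists e'.
Qed.

Lemma not_acyclic_le e T : ~ acyclic e T -> (e <= #|T|)%N.
Proof.
move=> nA; rewrite leqNgt; apply/negP => lt_eT; apply: nA => f _.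
exists (fun=> 0) => B sB _ cB.
by have := subset_leq_card sB; rewrite cB leqNgt lt_eT.
Qed.

Lemma not_acyclic_set0 e : ~ acyclic e set0 <-> e = 0%N.
Proof.
split=> [nA|-> /(_ (fun=> 1)) [|g gE]].
- case: e nA => // e; case=> f _; exists (fun=> 0) => B.
  by rewrite subset0 => /eqP-> _; rewrite cards0.
- by move=> B; rewrite subset0 => /eqP-> _; rewrite cards0.
- have ind0 : independent set0 by apply/independentP=> u w; rewrite inE.
  have := gE set0 (sub0set _) ind0 (cards0 _); rewrite /coboundary big_set0.
  by move/eqP; rewrite oner_eq0.
Qed.

(** By Hochster's formula this says that the Betti number of index i and degree
    j of the edge ideal does not vanish. *)
Definition hochster_nonzero i j :=
  exists T e, [/\ #|T| = j, (i + e)%N = j & ~ acyclic e T].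

Lemma not_acyclic_nbr e v T : ~ acyclic e T -> v \in T ->
  exists2 u, u \in T & G v u.
Proof.
move=> nA vT; apply/exists_inP; apply: contra_notT nA => /exists_inPn isoT.
exact: (acyclic_isolated vT).
Qed.

Let card_setDU1 v (R : {set 'I_n}) T : v \in T -> R \subset nbr v T ->
  [/\ #|T| = #|T :\ v|.+1, #|T| = (#|T :\: R| + #|R|)%N &
      #|T| = (#|(T :\: R) :\ v| + #|R|).+1].
Proof.
move=> vT sR; have c1 := cardsD1 v T; rewrite vT in c1.
have sRT : R \subset T.
  by apply: subset_trans sR _; apply/subsetP=> u; rewrite inE => /andP[].
have c2 : #|T| = (#|T :\: R| + #|R|)%N.
  by rewrite cardsD (setIidPr sRT) subnK // subset_leq_card.
have vR : v \in T :\: R.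
  rewrite inE vT andbT; apply/negP => /(subsetP sR).
  by rewrite inE G_irr andbF.
have c3 := cardsD1 v (T :\: R); rewrite vR add1n in c3; rewrite add1n in c1.
by split; rewrite // c2 c3 addSn.
Qed.

(** The index and the degree in not_acyclic_step, with any r neighbours of v as R. *)
Lemma hochster_step i r j T v : #|T| = j ->
  (exists2 e, (i + e)%N = j & ~ acyclic e T) -> v \in T ->
  (r <= #|nbr v T|)%N -> (r <= i)%N ->
  [\/ exists2 j', hochster_nonzero i.-1 j' & j = j'.+1,
      exists2 j', hochster_nonzero (i - r) j' & (j = j' + r)%N
    | exists2 j', hochster_nonzero (i - r) j' & (j = j' + r.+1)%N].
Proof.
move=> cT [e ej nA] vT rT ri.
have [R /andP[sR /eqP cR]] : exists R : {set 'I_n}, (R \subset nbr v T) && (#|R| == r).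
  have : (0 < 'C(#|nbr v T|, r))%N by rewrite bin_gt0.
  rewrite -(cards_draws (nbr v T) r) card_gt0 => /set0Pn[R].
  by rewrite inE => h; exists R.
have [c1 c2 c3] := card_setDU1 vT sR.
case: (not_acyclic_step vT sR nA) => [nD|nR|[e' ee' nL]].
- case: i ri ej => [|i] ri ej; last first.
    constructor 1; exists #|T :\ v|; last by lia.
    by exists (T :\ v), e; split=> //; lia.
  by have := not_acyclic_le nD; lia.
- constructor 2; exists #|T :\: R|; last by lia.
  by exists (T :\: R), e; split=> //; lia.
- constructor 3; exists #|(T :\: R) :\ v|; last by lia.
  by exists ((T :\: R) :\ v), e'; split=> //; lia.
Qed.

Lemma hochster_pred i j : hochster_nonzero i.+1 j ->
  exists2 j', hochster_nonzero i j' & (j <= j'.+2)%N.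
Proof.
case=> T [e [cT ej nA]].
have /set0Pn[v vT] : T != set0 by rewrite -card_gt0; lia.
have [u uT vu] := not_acyclic_nbr nA vT.
have u1 : (1 <= #|nbr v T|)%N.
  by rewrite card_gt0; apply/set0Pn; exists u; rewrite inE uT.
have := hochster_step cT (ex_intro2 _ _ e ej nA) vT u1 (ltn0Sn i).
rewrite subn1 /=.
by case=> -[j' hj' jE]; exists j' => //; lia.
Qed.

Lemma hochster_sub a b j : hochster_nonzero (a + b) j ->
  exists2 j', hochster_nonzero b j' & (j <= j' + 2 * a)%N.
Proof.
elim: a j => [|a IH] j h; first by exists j => //; lia.
have [j1 /IH[j2 h2 l2] l1] := hochster_pred h.
by exists j2 => //; lia.
Qed.

(** Removing one end of an edge of an induced matching leaves the other end
    isolated, so the only reduction that keeps cohomology alive removes the whole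
    edge, at the cost of one index and two degrees. *)
Lemma hochster_matching i e T a :
  (forall v, v \in T -> #|nbr v T| <= 1)%N -> (i + e)%N = #|T| ->
  ~ acyclic e T -> (a <= i)%N -> hochster_nonzero a (2 * a) /\ #|T| = (2 * i)%N.
Proof.
elim/ltn_ind: {T}#|T| {-2}T (erefl #|T|) i e a => k IH T eT i e a degT cT nA ai.
case: (eqVneq T set0) => [T0|/set0Pn[v vT]].
  move: nA cT; rewrite T0 cards0 => nA; have /not_acyclic_set0 e0 := nA.
  rewrite e0 addn0 => i0; have a0 : a = 0%N by lia.
  rewrite a0 i0; split=> //; exists set0, 0%N.
  by rewrite cards0; split=> //; rewrite -e0.
have [u uT vu] := not_acyclic_nbr nA vT.
have sR : [set u] \subset nbr v T by rewrite sub1set inE uT.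
have [c1 c2 c3] := card_setDU1 vT sR; rewrite cards1 in c2 c3.
have uv : u != v by apply: contraTneq vu => ->; rewrite G_irr.
have two_nbrs x y z :
    x \in T -> y \in T -> z \in T -> y != z -> G x y -> G x z -> False.
  move=> xT yT zT yz xy xz.
  have /subset_leq_card : [set y; z] \subset nbr x T.
    by apply/subsetP=> w; rewrite !inE => /orP[] /eqP->; rewrite ?yT ?zT.
  by rewrite cards2 yz; have := degT x xT; lia.
case: (not_acyclic_step vT sR nA) => [nD|nR|[e' ee' nL]].
- have uD : u \in T :\ v by rewrite !inE uv.
  have [w] := not_acyclic_nbr nD uD; rewrite !inE => /andP[wv wT] uw.
  by case: (two_nbrs u v w) => //; rewrite 1?eq_sym // G_sym.
- have vD : v \in T :\ u by rewrite !inE eq_sym uv.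
  have [w] := not_acyclic_nbr nR vD; rewrite !inE => /andP[wu wT] vw.
  by case: (two_nbrs v u w) => //; rewrite eq_sym.
pose T' := (T :\ u) :\ v.
have {}c3 : #|T| = #|T'|.+2 by rewrite c3 addn1.
have {}nL : ~ acyclic e' T' by [].
have T'E : T' = (T :\ u) :\ v by [].
clearbody T'.
have le' := not_acyclic_le nL.
case: i cT ai => [|i] cT ai; first by lia.
have degL w : w \in T' -> (#|nbr w T'| <= 1)%N.
  rewrite T'E !inE => /and3P[_ _ wT]; apply: leq_trans (degT w wT).
  apply/subset_leq_card/subsetP=> x; rewrite !inE => /andP[/and3P[_ _ ->]].
  by [].
have IHL a' : (a' <= i)%N -> hochster_nonzero a' (2 * a') /\ #|T'| = (2 * i)%N.
  by move=> a'i; apply: (IH _ _ _ erefl i e') => //; lia.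
have [_ cL] := IHL 0%N (leq0n _).
have {}cL : #|T| = (2 * i.+1)%N by lia.
split=> //; move: ai; rewrite leq_eqVlt => /orP[/eqP->|ai].
  by exists T, e; split=> //; lia.
by case: (IHL a).
Qed.

(** If no vertex of T has two neighbours in T, the induced graph is a matching;
    otherwise two neighbours of one vertex can be removed together. *)
Lemma hochster_pred2 i j : hochster_nonzero i.+2 j ->
  [\/ forall a, (a <= i.+2)%N -> hochster_nonzero a (2 * a),
      exists2 j', hochster_nonzero i.+1 j' & (j <= j'.+1)%N
    | exists2 j', hochster_nonzero i j' & (j <= j'.+3)%N].
Proof.
case=> T [e [cT ej nA]].
case: (classic (exists2 v, v \in T & (2 <= #|nbr v T|)%N)) => [[v vT deg2]|no_deg2].
  have := hochster_step cT (ex_intro2 _ _ e ej nA) vT deg2 isT.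
  rewrite /= subn2 /=.
  by case=> -[j' hj' jE]; [constructor 2|constructor 3|constructor 3];
    exists j' => //; lia.
constructor 1 => a ai.
have [||//] := @hochster_matching i.+2 e T a _ _ nA ai; last by rewrite cT.
by move=> v vT; rewrite leqNgt; apply/negP => deg2; apply: no_deg2; exists v.
Qed.

(** Either an induced matching is met during the descent, or every two steps of
    index cost at most three degrees; the rounding up pays for a last single step
    when b is odd. *)
Lemma hochster_descent a b j : hochster_nonzero (a + b) j ->
  hochster_nonzero a (2 * a) \/
  exists2 j', hochster_nonzero a j' & (j <= j' + uphalf (3 * b))%N.
Proof.
elim/ltn_ind: b j => -[|[|b]] IH j h.
- by right; exists j; rewrite ?addn0 // in h *.
- have [j' h' l'] : exists2 j', hochster_nonzero a j' & (j <= j'.+2)%N.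
    by apply: hochster_pred; rewrite -addn1.
  by right; exists j' => //; rewrite [uphalf _]/=; lia.
rewrite !addnS in h; case: (hochster_pred2 h) => [hm|[j' h' l']|[j' h' l']].
- by left; apply: hm; lia.
- rewrite -addnS in h'; case: (IH _ _ _ h') => // [|[j2 h2 l2]]; first by left.
  by right; exists j2 => //; lia.
- case: (IH _ _ _ h') => // [|[j2 h2 l2]]; first by left.
  by right; exists j2 => //; lia.
Qed.

End Cochains.

(** * Koszul complexes *)

Section Koszul.
Variables (R : comNzRingType) (n : nat) (M : lmodType R) (x : 'I_n -> R).
Implicit Types (f g : {set 'I_n} -> M) (v w : 'I_n) (A B : {set 'I_n}).

(** The Koszul complex on x with coefficients in M; f A is the coefficient of the
    exterior monomial of the elements of A. *)
Definition koszul f A : M :=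
  \sum_(v | v \notin A) ((-1) ^+ inv_parity v A * x v) *: f (v |: A).

Lemma koszul_ext f g A :
  (forall v, v \notin A -> f (v |: A) = g (v |: A)) -> koszul f A = koszul g A.
Proof. by move=> fg; apply: eq_bigr => v vA; rewrite fg. Qed.

Lemma koszulB f g A : koszul (fun B => f B - g B) A = koszul f A - koszul g A.
Proof. by rewrite -sumrB; apply: eq_bigr => v _; rewrite scalerBr. Qed.

Lemma koszul_koszul f A : koszul (koszul f) A = 0.
Proof.
pose a v w := if [&& v \notin A, w \notin A & v != w] then
  ((-1) ^+ (inv_parity v A (+) inv_parity w (v |: A)) * (x v * x w))
    *: f (w |: (v |: A)) else 0.
rewrite -[RHS](@sum_antisymmetric n M a); last 2 first.
- by move=> v; rewrite /a eqxx !andbF.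
- move=> v w vw; rewrite /a (eq_sym w v) andbCA; case: ifP => [|_]; last first.
    by rewrite oppr0.
  case/and3P=> wA vA _; rewrite addbC inv_parity_swap // 1?eq_sym //.
  by rewrite addbC signrN mulNr scaleNr (mulrC (x w)) setUCA.
rewrite /koszul [LHS]big_mkcond; apply: eq_bigr => v _.
case: ifP => [vA|vA]; last by rewrite big1 // => w _; rewrite /a vA.
rewrite scaler_sumr big_mkcond; apply: eq_bigr => w _.
rewrite /a vA /= !inE negb_or; case: (eqVneq w v) => [->|wv]; first by rewrite andbF.
rewrite /= andbT; case: ifP => // wA.
by rewrite scalerA signr_addb; congr (_ *: _); rewrite mulrACA.
Qed.

Definition toggle w f A : M :=
  if w \in A then (-1) ^+ inv_parity w A *: f (A :\ w) else 0.

(** The Koszul complex is contractible as soon as one x w acts as the identity. *)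
Lemma koszul_homotopy w f A : x w = 1 ->
  f A = koszul (toggle w f) A + toggle w (koszul f) A.
Proof.
move=> xw; rewrite {2}/toggle; case: (boolP (w \in A)) => wA; last first.
  rewrite addr0 /koszul (bigD1 w) //= big1 ?addr0; last first.
    by move=> v /andP[vA vw]; rewrite /toggle !inE eq_sym (negbTE vw) (negbTE wA) scaler0.
  rewrite /toggle setU11 inv_parityU1_id // setU1K // xw mulr1.
  by rewrite scalerA -signr_addb addbb scale1r.
have [A' wA' ->] : exists2 A' : {set 'I_n}, w \notin A' & A = w |: A'.
  by exists (A :\ w); rewrite ?setD1K // !inE eqxx.
rewrite inv_parityU1_id // setU1K // {2}/koszul (bigD1 w) //= scalerDr.
rewrite xw mulr1 scalerA -signr_addb addbb scale1r addrCA -[LHS]addr0.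
congr (_ + _); rewrite /koszul scaler_sumr.
rewrite (eq_bigl (fun v => (v \notin A') && (v != w))); last first.
  by move=> v; rewrite !inE negb_or andbC.
rewrite -big_split big1 //= => v /andP[vA' vw].
rewrite /toggle setUCA setU11 setU1K; last by rewrite !inE eq_sym negb_or vw.
rewrite inv_parityU1_id; last by rewrite !inE eq_sym negb_or vw.
rewrite !scalerA -scalerDl mulrAC -signr_addb inv_parity_swapU //.
by rewrite signrN mulNr mulrA -signr_addb addNr scale0r.
Qed.

End Koszul.

(** * Strands of the Koszul complex of a polynomial module *)

Section Coefficients.
Variables (K : fieldType) (n : nat).
Notation S := {mpoly K[n]}.
Implicit Types (p q : S) (m u : 'X_{1..n}) (A B : {set 'I_n}).

Lemma mnm1_le m v : m v != 0%N -> (U_(v) <= m)%MM.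
Proof.
by move=> mv; apply/mnm_lepP=> i; rewrite mnm1E; case: eqP => // <-; rewrite lt0n.
Qed.

Definition mpoly_of_coef (b : nat) (E : 'X_{1..n} -> K) : S :=
  \sum_(m : 'X_{1..n < b}) E m *: 'X_[m].

Lemma mcoeff_mpoly_of_coef b E m :
  (mpoly_of_coef b E)@_m = if (mdeg m < b)%N then E m else 0.
Proof.
case: ifP => mb; first exact: mcoeff_mpoly.
rewrite raddf_sum big1 // => -[m' m'b] _ /=; rewrite mcoeffZ mcoeffX.
by case: eqP => [e|_]; rewrite ?mulr0 //; rewrite -e m'b in mb.
Qed.

Lemma mcoeff_msize_le p m : (msize p <= mdeg m)%N -> p@_m = 0.
Proof. by move/msize_mdeg_ge/memN_msupp_eq0. Qed.

Lemma mcoeff_signM (b : bool) p m : ((-1) ^+ b * p)@_m = (-1) ^+ b * p@_m.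
Proof. by case: b; rewrite ?expr0 ?expr1 ?mul1r ?mulN1r ?mcoeffN. Qed.

Lemma mcoeff_XM v p m : ('X_v * p)@_m = if m v != 0%N then p@_(m - U_(v)) else 0.
Proof.
rewrite mulrC; case: ifP => mv.
  by rewrite -{1}(submK (mnm1_le mv)) addmC mcoeffMX.
apply: memN_msupp_eq0; rewrite (perm_mem (msuppMX _ _)); apply/mapP => -[m' _ e].
by move: mv; rewrite e mnmDE mnm1E eqxx.
Qed.

Definition pkoszul r := @koszul S n 'rV[S]_r (fun v => 'X_v).

Lemma mcoeff_pkoszul r (f : {set 'I_n} -> 'rV[S]_r) A k m :
  (pkoszul f A 0 k)@_m = \sum_(v | v \notin A) (-1) ^+ inv_parity v A *
    (if m v != 0%N then (f (v |: A) 0 k)@_(m - U_(v)) else 0).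
Proof.
rewrite summxE raddf_sum; apply: eq_bigr => v vA /=.
by rewrite mxE -mulrA mcoeff_signM mcoeff_XM.
Qed.

Definition vsupp u : {set 'I_n} := [set v | u v != 0%N].

Lemma mesym1_le A u : A \subset vsupp u -> (mesym1 A <= u)%MM.
Proof.
move=> sA; apply/mnm_lepP=> v; rewrite mnmE; case: (boolP (v \in A)) => // vA.
by have := subsetP sA v vA; rewrite inE lt0n.
Qed.

Lemma vsupp_mesym1 A : vsupp (mesym1 A) = A.
Proof. by apply/setP=> v; rewrite inE mnmE; case: (v \in A). Qed.

(** The part of multidegree u of the Koszul complex of the polynomial ring has
    basis the squarefree divisors of the monomial u. *)
Definition strand u := @koszul K n K^o (fun v => (v \in vsupp u)%:R).

Definition strand_coef u r (k : 'I_r) (f : {set 'I_n} -> 'rV[S]_r) A : K^o :=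
  if A \subset vsupp u then (f A 0 k)@_(u - mesym1 A) else 0.

Lemma strand_coefE u r (k : 'I_r) (f : {set 'I_n} -> 'rV[S]_r) A :
  A \subset vsupp u ->
  (pkoszul f A 0 k)@_(u - mesym1 A) = strand u (strand_coef u k f) A.
Proof.
move=> sA; rewrite mcoeff_pkoszul; apply: eq_bigr => v vA.
rewrite /strand_coef subUset sub1set sA andbT inE mnmBE mnmE (negbTE vA) subn0.
case: ifP => uv; last by rewrite mulr0 scale0r.
rewrite mulr1; congr (_ * _@__); apply/mnmP=> i; rewrite !mnmE !inE.
by case: (eqVneq i v) => [->|]; rewrite ?(negbTE vA) ?subn0 //= 1?subn0.
Qed.

(** Solving f = d g can be done multidegree by multidegree; only the finitely many
    multidegrees that occur in f matter. The predicate P selects the monomials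
    whose coefficients are compared, so that this covers congruences modulo a
    monomial ideal. *)
Lemma pkoszul_lift (P : pred 'X_{1..n}) r (f : {set 'I_n} -> 'rV[S]_r) :
  (forall u (k : 'I_r), exists g, forall A, A \subset vsupp u ->
     P (u - mesym1 A)%MM -> strand_coef u k f A = strand u g A) ->
  exists g, forall A k m, P m -> (f A 0 k)@_m = (pkoszul g A 0 k)@_m.
Proof.
move=> H.
(* beyond degree b, the multidegree u does not occur in f *)
pose b := (\max_(A : {set 'I_n}) \max_(k < r) msize (f A 0%R k) + n.+1)%N.
have [g0 g0E] : exists g0 : 'X_{1..n < b} * 'I_r -> {set 'I_n} -> K^o,
    forall (uk : 'X_{1..n < b} * 'I_r) A,
      A \subset vsupp uk.1 -> P (uk.1 - mesym1 A)%MM ->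
      strand_coef uk.1 uk.2 f A = strand uk.1 (g0 uk) A.
  apply: (@fin_all_exists _ (fun=> {set 'I_n} -> K^o)
    (fun (uk : 'X_{1..n < b} * 'I_r) g => forall A,
    A \subset vsupp uk.1 -> P (uk.1 - mesym1 A)%MM ->
      strand_coef uk.1 uk.2 f A = strand uk.1 g A)).
  by case=> u k; apply: H.
pose g1 u k A : K := if insub u is Some u' then g0 (u', k) A else 0.
exists (fun A => \row_k mpoly_of_coef b (fun m => g1 (m + mesym1 A)%MM k A)).
move=> A k m Pm; set G := (fun A => _).
pose u := (m + mesym1 A)%MM.
have mE : m = (u - mesym1 A)%MM by rewrite /u addmK.
have sA : A \subset vsupp u.
  by apply/subsetP=> v vA; rewrite inE mnmDE mnmE vA addn1.
have GE B : B \subset vsupp u -> strand_coef u k G B = g1 u k B.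
  move=> sB; rewrite /strand_coef sB mxE mcoeff_mpoly_of_coef.
  rewrite submK ?mesym1_le //; case: ifP => // ub.
  rewrite /g1; case: insubP => // u' u'b _.
  by have := leq_ltn_trans (mdegB u (mesym1 B)) u'b; rewrite ub.
rewrite mE strand_coefE //.
have -> : strand u (strand_coef u k G) A = strand u (g1 u k) A.
  rewrite /strand [LHS]big_mkcond [RHS]big_mkcond; apply: eq_bigr => v _.
  case: ifP => // vA; case: (boolP (v \in vsupp u)) => vu;
    last by rewrite mulr0 !scale0r.
  by rewrite GE // subUset sub1set vu.
rewrite -mE; have <- : strand_coef u k f A = (f A 0 k)@_m.
  by rewrite /strand_coef sA -mE.
rewrite /g1; case: insubP => [u' u'b u'E|ub].
  have := g0E (u', k) A; rewrite /= u'E => -> //.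
  by rewrite -mE.
rewrite /strand /koszul big1 => [|v _]; last by rewrite scaler0.
rewrite /strand_coef sA -mE mcoeff_msize_le //.
have le1 : (msize (f A 0%R k) <=
    \max_(B : {set 'I_n}) \max_(l < r) msize (f B 0%R l))%N.
  apply: leq_trans (leq_bigmax A); exact: (leq_bigmax k).
move: ub; rewrite /b /u mdegD mdeg_mesym1 -leqNgt.
by have := max_card A; rewrite card_ord; lia.
Qed.

End Coefficients.

Section Exactness.
Variables (K : fieldType) (n : nat).
Notation S := {mpoly K[n]}.
Implicit Types (m u : 'X_{1..n}) (A : {set 'I_n}).

Lemma strand_homotopy u w (c : {set 'I_n} -> K^o) A : w \in vsupp u ->
  c A = strand u (toggle w c) A + toggle w (strand u c) A.
Proof. by move=> wu; apply: koszul_homotopy => /=; rewrite wu. Qed.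

Lemma vsupp_eq0 u : (vsupp u == set0) = (u == 0%MM).
Proof.
apply/eqP/eqP => [/setP h|->]; last by apply/setP=> v; rewrite !inE mnm0E.
by apply/mnmP=> v; have := h v; rewrite !inE mnm0E; case: eqP.
Qed.

Lemma pkoszul_mul r r' (f : {set 'I_n} -> 'rV[S]_r) (D : 'M[S]_(r, r')) A :
  pkoszul (fun B => f B *m D) A = pkoszul f A *m D.
Proof. by rewrite mulmx_suml; apply: eq_bigr => v _; rewrite scalemxAl. Qed.

Lemma mcoeff0_pkoszul r (f : {set 'I_n} -> 'rV[S]_r) A k :
  (pkoszul f A 0 k)@_0%MM = 0.
Proof. by rewrite mcoeff_pkoszul big1 // => v _; rewrite mnm0E mulr0. Qed.

(** The Koszul complex resolves K: in a multidegree other than zero, some variable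
    acts as the identity on the strand. *)
Lemma pkoszul_exact r (f : {set 'I_n} -> 'rV[S]_r) :
  (forall A, pkoszul f A = 0) -> (forall k, (f set0 0 k)@_0%MM = 0) ->
  exists g, forall A, f A = pkoszul g A.
Proof.
move=> f0 fc.
have [u k|g gE] := @pkoszul_lift K n predT r f; last first.
  by exists g => A; apply/rowP=> k; apply/mpolyP=> m; apply: gE.
case: (set_0Vmem (vsupp u)) => [u0|[w wu]].
  exists (fun=> 0) => A; rewrite u0 subset0 => /eqP-> _.
  move/eqP: u0; rewrite vsupp_eq0 => /eqP->.
  rewrite /strand_coef sub0set sub0m fc /strand /koszul big1 // => v _.
  by rewrite scaler0.
exists (toggle w (strand_coef u k f)) => A sA _.
rewrite [LHS](strand_homotopy _ _ wu) /toggle; case: ifP => wA; last by rewrite addr0.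
have sAw : A :\ w \subset vsupp u := subset_trans (subsetDl _ _) sA.
by rewrite -strand_coefE // f0 mxE mcoeff0 scaler0 addr0.
Qed.

(** ** Homogeneous components *)

Definition mfilter (Q : pred 'X_{1..n}) (p : S) : S :=
  mpoly_of_coef (msize p) (fun m => if Q m then p@_m else 0).

Lemma mcoeff_mfilter Q p m : (mfilter Q p)@_m = if Q m then p@_m else 0.
Proof.
rewrite mcoeff_mpoly_of_coef; case: ltnP => // h; case: ifP => // _.
by rewrite mcoeff_msize_le.
Qed.

Lemma mfilter_mul (Q1 Q2 : pred 'X_{1..n}) (p q : S) :
  (forall m1 m2, q@_m2 != 0 -> Q2 (m1 + m2)%MM = Q1 m1) ->
  mfilter Q1 p * q = mfilter Q2 (p * q).
Proof.
move=> Q12; apply/mpolyP=> m; rewrite mcoeff_mfilter !mcoeffM.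
have -> : (if Q2 m then \sum_(k : 'X_{1..n < (mdeg m).+1, (mdeg m).+1}
      | m == (k.1 + k.2)%MM) p@_k.1 * q@_k.2 else 0) =
    \sum_(k : 'X_{1..n < (mdeg m).+1, (mdeg m).+1} | m == (k.1 + k.2)%MM)
      if Q2 m then p@_k.1 * q@_k.2 else 0.
  by case: ifP => // _; rewrite big1.
apply: eq_bigr => k /eqP mE; rewrite mcoeff_mfilter.
case: (eqVneq q@_k.2 0) => [->|qk]; first by rewrite !mulr0 if_same.
have -> : Q2 m = Q1 k.1 by rewrite [in LHS]mE Q12.
by case: ifP => _; rewrite ?mul0r.
Qed.

(** The component of Koszul degree p and total degree j, when the k-th basis
    vector of the free module has degree s k; a generator of the exterior algebra
    has degree 1. *)
Definition part r (s : 'I_r -> nat) (p j : nat) (f : {set 'I_n} -> 'rV[S]_r) A :=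
  \row_k mfilter (fun m => (#|A| == p) && (mdeg m + s k + p == j)%N) (f A 0 k).

Lemma mcoeff_part r (s : 'I_r -> nat) p j f A k m :
  (part s p j f A 0 k)@_m =
  if (#|A| == p) && (mdeg m + s k + p == j)%N then (f A 0 k)@_m else 0.
Proof. by rewrite mxE mcoeff_mfilter. Qed.

Lemma part_mul r r' (s : 'I_r -> nat) (s' : 'I_r' -> nat) p j f
    (D : 'M[S]_(r, r')) A :
  (forall k l, homog_from (s' l) (s k) (D k l)) ->
  part s p j f A *m D = part s' p j (fun B => f B *m D) A.
Proof.
move=> homD; apply/rowP=> l; apply/mpolyP=> m; rewrite mcoeff_part.
rewrite !mxE raddf_sum.
have -> : (if (#|A| == p) && (mdeg m + s' l + p == j)%N then
    (\sum_k f A 0 k * D k l)@_m else 0) =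
  \sum_k (mfilter (fun m => (#|A| == p) && (mdeg m + s' l + p == j)%N)
            (f A 0 k * D k l))@_m.
  under [RHS]eq_bigr do rewrite mcoeff_mfilter.
  by case: ifP => _; rewrite ?raddf_sum //= big1.
apply: eq_bigr => k _ /=; rewrite mxE; congr _@__.
apply: mfilter_mul => m1 m2 m2D; congr (_ && (_ == _)).
have := homD k l m2; rewrite mcoeff_msupp m2D mdegD => /(_ isT); lia.
Qed.

Lemma part_pkoszul r (s : 'I_r -> nat) p j f A :
  pkoszul (part s p.+1 j f) A = part s p j (pkoszul f) A.
Proof.
apply/rowP=> k; apply/mpolyP=> m; rewrite mcoeff_part !mcoeff_pkoszul.
rewrite (eq_bigr (fun v => if (#|A| == p) && (mdeg m + s k + p == j)%N then
  (-1) ^+ inv_parity v A *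
   (if m v != 0%N then (f (v |: A) 0 k)@_(m - U_(v)) else 0) else 0)).
  by case: ifP => // _; rewrite big1.
move=> v vA; rewrite mcoeff_part cardsU1 vA add1n eqSS.
case: (boolP (m v == 0%N)) => /= mv; first by rewrite mulr0 if_same.
have <- : (mdeg (m - U_(v))%MM + s k + p.+1 = mdeg m + s k + p)%N.
  by rewrite -[in RHS](submK (mnm1_le mv)) mdegD mdeg1; lia.
by case: ifP => _; rewrite ?mulr0.
Qed.

Definition homogeneous r (s : 'I_r -> nat) p j f := forall A, part s p j f A = f A.

Lemma part_homogeneous r (s : 'I_r -> nat) p j f : homogeneous s p j (part s p j f).
Proof.
move=> A; apply/rowP=> k; apply/mpolyP=> m; rewrite !mcoeff_part.
by case: (_ && _).
Qed.

Lemma part_ext r (s : 'I_r -> nat) p j f g A :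
  f A = g A -> part s p j f A = part s p j g A.
Proof. by rewrite /part => ->. Qed.

Lemma homogeneousP r (s : 'I_r -> nat) p j f :
  homogeneous s p j f <->
  forall A k m, (f A 0 k)@_m != 0 -> #|A| = p /\ (mdeg m + s k + p = j)%N.
Proof.
split=> [h A k m|h A].
  by rewrite -h mcoeff_part; case: ifP => [/andP[/eqP-> /eqP<-]|_]; rewrite ?eqxx.
apply/rowP=> k; apply/mpolyP=> m; rewrite mcoeff_part; case: ifP => // c.
case: (eqVneq (f A 0 k)@_m 0) => [->//|/h[cA cm]].
by rewrite cA cm !eqxx in c.
Qed.

Lemma homogeneous_card r (s : 'I_r -> nat) p j f A :
  homogeneous s p j f -> #|A| != p -> f A = 0.
Proof.
move/homogeneousP=> h cA; apply/rowP=> k; apply/mpolyP=> m; rewrite mxE mcoeff0.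
by apply: contraNeq cA => /h[-> _].
Qed.

End Exactness.

(** * Betti numbers of monomial ideals through the Koszul complex *)

Section MonomialIdeal.
Variables (K : fieldType) (n : nat).
Notation S := {mpoly K[n]}.
Notation M r := ({set 'I_n} -> 'rV[S]_r).
Implicit Types (m u : 'X_{1..n}) (A : {set 'I_n}).

Variables (I : S -> Prop) (P : pred 'X_{1..n}).
Hypothesis P_down : forall m1 m2, P (m1 + m2)%MM -> P m2.
Hypothesis I_monomial : forall p, I p <-> forall m, P m -> p@_m = 0.

Definition eq_mod_ideal (y z : M 1) := forall A m, P m -> (y A 0 0)@_m = (z A 0 0)@_m.

Lemma eq_mod_ideal_pkoszul y z :
  eq_mod_ideal y z -> eq_mod_ideal (pkoszul y) (pkoszul z).
Proof.
move=> yz A m Pm; rewrite !mcoeff_pkoszul; apply: eq_bigr => v _.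
case: ifP => // mv; rewrite yz //.
by apply: (P_down (m1 := U_(v)%MM)); rewrite addmC submK // mnm1_le.
Qed.

Variable F : graded_free_complex K n.
Hypothesis F_res : graded_free_resolution I F.

Let diff_homog i : forall k l, homog_from (shift l) (shift k) (diff F i k l).
Proof. by case: F_res => h _ _; apply: h. Qed.

Let aug_homog : forall k l, homog_from 0 (shift k) (aug F k l).
Proof. by case: F_res => _ h _ k l; rewrite ord1; apply: h. Qed.

Let aug_surj (s : S) : exists x : 'rV[S]_(rk F 0), I ((x *m aug F) 0 0 - s).
Proof. by case: F_res => _ _ []. Qed.

Let aug_exact (x : 'rV[S]_(rk F 0)) :
  I ((x *m aug F) 0 0) <-> exists y, y *m diff F 0 = x.
Proof. by case: F_res => _ _ []. Qed.

Let diff_exact i (x : 'rV[S]_(rk F i.+1)) :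
  x *m diff F i = 0 <-> exists y, y *m diff F i.+1 = x.
Proof. by case: F_res => _ _ [_ _ h]; apply: h. Qed.

Let diff_diff i (x : 'rV[S]_(rk F i.+2)) : x *m diff F i.+1 *m diff F i = 0.
Proof. by apply/diff_exact; exists x. Qed.

(** The ring S as a graded free module of rank one. *)
Definition unshifted (k : 'I_1) := 0%N.

(** The classes of x and z correspond to each other under the isomorphism of
    Tor computed from F and from the Koszul complex: a staircase in the double
    complex of F tensored with the Koszul complex joins them. The differential of
    the Koszul complex ignores the value at the empty set; requiring it to vanish
    on the intermediate steps is what makes exactness of the Koszul complex
    available there, in degree zero too. *)
Fixpoint zigzag q : M (rk F q) -> M 1 -> Prop :=
  match q return M (rk F q) -> M 1 -> Prop with
  | 0 => fun x z => eq_mod_ideal (fun A => x A *m aug F) z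
  | q'.+1 => fun x z => exists x' : M (rk F q'),
      [/\ x' set0 = 0, forall A, x A *m diff F q' = pkoszul x' A
        & zigzag x' z]
  end.

Definition koszul_cycle (z : M 1) := eq_mod_ideal (pkoszul z) (fun=> 0).

Lemma zigzag_pkoszul q (x : M (rk F q)) z :
  koszul_cycle z -> zigzag x z ->
  exists y : M (rk F q.+1), forall A, y A *m diff F q = pkoszul x A.
Proof.
move=> cz xz; apply: (@fin_all_exists _ (fun=> 'rV[S]_(rk F q.+1))
  (fun A y => y *m diff F q = pkoszul x A)) => A.
case: q x xz => [|q] x /=.
  move=> xz; apply/aug_exact/I_monomial => m Pm.
  by rewrite -pkoszul_mul (eq_mod_ideal_pkoszul xz) // cz // mxE mcoeff0.
case=> x' [_ xx' _]; apply/diff_exact; rewrite -pkoszul_mul.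
rewrite -[RHS](koszul_koszul (fun v => 'X_v) x' A).
by apply: koszul_ext => v _; rewrite xx'.
Qed.

(** Climbing the staircase from the Koszul complex of S/I to F, by exactness of F;
    homogeneity is restored at each step by taking a component. *)
Lemma zigzag_of_koszul q p j z :
  homogeneous unshifted (p + q) j z -> koszul_cycle z ->
  exists2 x : M (rk F q), homogeneous (@shift _ _ F q) p j x & zigzag x z.
Proof.
move=> + cz; elim: q p => [|q IH] p hz.
  rewrite addn0 in hz.
  have [x xE] : exists x : M (rk F 0), forall A, I ((x A *m aug F) 0 0 - z A 0 0).
    apply: (@fin_all_exists _ (fun=> 'rV[S]_(rk F 0))
      (fun A x => I ((x *m aug F) 0 0 - z A 0 0))) => A.
    exact: aug_surj.
  exists (part (@shift _ _ F 0) p j x); first exact: part_homogeneous.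
  move=> A m Pm; rewrite (@part_mul _ _ _ _ _ unshifted) // -hz !mcoeff_part.
  case: ifP => // _; apply/eqP; rewrite -subr_eq0 -mcoeffB; apply/eqP.
  by move/I_monomial: (xE A); apply.
have [x' hx' x'z] : exists2 x' : M (rk F q), homogeneous (@shift _ _ F q) p.+1 j x'
    & zigzag x' z by apply: IH; rewrite addSnnS.
have [y yE] := zigzag_pkoszul cz x'z.
exists (part (@shift _ _ F q.+1) p j y); first exact: part_homogeneous.
exists x'; split=> //; first by rewrite (homogeneous_card hx') // cards0.
move=> A; rewrite (@part_mul _ _ _ _ _ (@shift _ _ F q)) //.
rewrite (part_ext _ _ _ (yE A)) -part_pkoszul.
by apply: koszul_ext => v _; rewrite hx'.
Qed.

(** A staircase that ends at a boundary consists of boundaries of the total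
    complex. *)
Lemma zigzag_boundary q (x : M (rk F q)) z y :
  zigzag x z -> eq_mod_ideal z (pkoszul y) ->
  exists (w : M (rk F q)) (w' : M (rk F q.+1)),
    forall A, x A = pkoszul w A + w' A *m diff F q.
Proof.
move=> + zy; elim: q x => [|q IH] x /=.
  move=> xz.
  have [w wE] : exists w : M (rk F 0), forall A, I ((w A *m aug F) 0 0 - y A 0 0).
    apply: (@fin_all_exists _ (fun=> 'rV[S]_(rk F 0))
      (fun A x => I ((x *m aug F) 0 0 - y A 0 0))) => A.
    exact: aug_surj.
  have wy : eq_mod_ideal (fun A => w A *m aug F) y.
    move=> A m Pm; apply/eqP; rewrite -subr_eq0 -mcoeffB; apply/eqP.
    by move/I_monomial: (wE A); apply.
  have [w' w'E] : exists w' : M (rk F 1), forall A,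
      w' A *m diff F 0 = x A - pkoszul w A.
    apply: (@fin_all_exists _ (fun=> 'rV[S]_(rk F 1))
      (fun A w' => w' *m diff F 0 = x A - pkoszul w A)) => A.
    apply/aug_exact/I_monomial => m Pm.
    rewrite mulmxBl -pkoszul_mul mxE [X in _ + X]mxE mcoeffB.
    by rewrite (eq_mod_ideal_pkoszul wy) // xz // zy // subrr.
  by exists w, w' => A; rewrite w'E addrC subrK.
case=> x' [_ xx' /IH[w [w' x'E]]].
have [w'' w''E] : exists w'' : M (rk F q.+2), forall A,
    w'' A *m diff F q.+1 = x A - pkoszul w' A.
  apply: (@fin_all_exists _ (fun=> 'rV[S]_(rk F q.+2))
    (fun A w'' => w'' *m diff F q.+1 = x A - pkoszul w' A)) => A.
  apply/diff_exact; rewrite mulmxBl xx' -pkoszul_mul -koszulB.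
  rewrite -[RHS](koszul_koszul (fun v => 'X_v) w A).
  by apply: koszul_ext => v _; rewrite x'E addrK.
by exists w', w'' => A; rewrite w''E addrC subrK.
Qed.

Definition koszul_liftable q : M (rk F q) -> Prop :=
  match q return M (rk F q) -> Prop with
  | 0 => fun=> True
  | q'.+1 => fun x => exists x' : M (rk F q'),
      forall A, x A *m diff F q' = pkoszul x' A
  end.

(** Going down the staircase from F to the Koszul complex of S/I, by exactness of
    the Koszul complex. *)
Lemma zigzag_to_koszul q p j (x : M (rk F q)) :
  homogeneous (@shift _ _ F q) p j x ->
  (exists y : M (rk F q.+1), forall A, y A *m diff F q = pkoszul x A) ->
  koszul_liftable x ->
  exists z, [/\ homogeneous unshifted (p + q) j z, koszul_cycle z & zigzag x z].
Proof.
elim: q p x => [|q IH] p x hx [y yE] /=.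
  move=> _; exists (fun A => x A *m aug F); split=> //.
    by rewrite addn0 => A; rewrite -(@part_mul _ _ _ _ (@shift _ _ F 0)) // hx.
  move=> A m Pm; rewrite pkoszul_mul [in RHS]mxE mcoeff0.
  by have /aug_exact/I_monomial : exists y, y *m diff F 0 = pkoszul x A;
    [exists (y A) | apply].
case=> x1 x1E; pose x' := part (@shift _ _ F q) p.+1 j x1.
have hx' : homogeneous (@shift _ _ F q) p.+1 j x' by apply: part_homogeneous.
have x'E A : x A *m diff F q = pkoszul x' A.
  rewrite part_pkoszul.
  transitivity (part (@shift _ _ F q) p j (fun B => x B *m diff F q) A).
    2: exact: part_ext.
  by rewrite -(@part_mul _ _ _ _ (@shift _ _ F q.+1)) // hx.
have x'0 : x' set0 = 0 by rewrite (homogeneous_card hx') // cards0.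
clearbody x'; have [||z [hz cz x'z]] := IH p.+1 x' hx'.
- by exists x.
- case: q x x' x'E x'0 {IH x1 x1E hx hx' y yE} => //= q x x' x'E x'0.
  apply: pkoszul_exact => [A|k]; last by rewrite x'0 mul0mx mxE mcoeff0.
  by rewrite pkoszul_mul -x'E diff_diff.
by exists z; rewrite -addSnnS; split=> //; exists x'.
Qed.

(** Conversely, if the staircase starts at a boundary, it ends at one. *)
Lemma zigzag_boundary_inv q (x : M (rk F q)) z w (w' : M (rk F q.+1)) :
  zigzag x z -> (forall A, x A = pkoszul w A + w' A *m diff F q) ->
  exists y, eq_mod_ideal z (pkoszul y).
Proof.
elim: q x w w' => [|q IH] x w w' /=.
  move=> xz xE; exists (fun A => w A *m aug F) => A m Pm.
  rewrite -xz // xE mulmxDl mxE mcoeffD -pkoszul_mul.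
  have /aug_exact/I_monomial h : exists y,
    y *m diff F 0 = w' A *m diff F 0 by exists (w' A).
  by rewrite h // addr0.
case=> x' [x'0 xx' x'z] xE.
(* the value at set0 does not contribute to the differential *)
pose w0 A := if A == set0 then 0 else w A.
have w0E A : pkoszul w0 A = pkoszul w A.
  apply: koszul_ext => v _; rewrite /w0; case: eqP => // /setP/(_ v).
  by rewrite !inE eqxx.
have [||w1 w1E] := @pkoszul_exact K n _ (fun A => x' A - w0 A *m diff F q).
- move=> A; rewrite [LHS]koszulB -/(pkoszul _ _) -/(pkoszul _ _) pkoszul_mul -xx' xE w0E.
  by rewrite mulmxDl diff_diff addr0 subrr.
- by move=> k; rewrite x'0 /w0 eqxx mul0mx subr0 mxE mcoeff0.
by apply: (IH x' w1 w0) => // A; rewrite -w1E subrK.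
Qed.

(** ** Constant terms *)

Lemma chainsKP i j (w : 'rV[K]_(rk F i)) :
  reflect (forall k, w 0 k != 0 -> shift k = j) (w <= chainsK F i j)%MS.
Proof.
apply: (iffP submxP) => [[v ->] k|h].
  rewrite mul_mx_diag !mxE; case: (eqVneq (shift k) j) => // _.
  by rewrite mulr0n mulr0 eqxx.
exists w; apply/rowP=> k; rewrite mul_mx_diag !mxE.
by case: (eqVneq (w 0 k) 0) => [->|/h->]; rewrite ?mul0r // eqxx mulr1.
Qed.

Definition const_part r (v : 'rV[S]_r) : 'rV[K]_r := map_mx (mcoeff 0%MM) v.
Definition const_lift r (w : 'rV[K]_r) : 'rV[S]_r := map_mx (@mpolyC n K) w.

Lemma const_partK r (w : 'rV[K]_r) : const_part (const_lift w) = w.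
Proof. by apply/rowP=> k; rewrite !mxE mpolyCK. Qed.

Lemma const_part_mul i (v : 'rV[S]_(rk F i.+1)) :
  const_part (v *m diff F i) = const_part v *m diffK F i.
Proof. exact: map_mxM. Qed.

Lemma const_part_pkoszul r (f : M r) A : const_part (pkoszul f A) = 0.
Proof. by apply/rowP=> k; rewrite mxE mcoeff0_pkoszul mxE. Qed.

Lemma chainsK_homogeneous i p j (x : M (rk F i)) :
  homogeneous (@shift _ _ F i) p j x -> (const_part (x set0) <= chainsK F i j)%MS.
Proof.
move=> /homogeneousP hx; apply/chainsKP=> k; rewrite mxE => /hx[].
by rewrite cards0 mdeg0 add0n => <-; rewrite addn0.
Qed.

(** An element of F tensored with the zeroth exterior power. *)
Definition at_set0 r (v : 'rV[S]_r) : M r := fun A => if A == set0 then v else 0.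

Lemma pkoszul_at_set0 r (v : 'rV[S]_r) A : pkoszul (at_set0 v) A = 0.
Proof.
rewrite /pkoszul /koszul big1 // => u _; rewrite /at_set0.
by case: eqP => [/setP/(_ u)|_]; rewrite ?scaler0 // !inE eqxx.
Qed.

Lemma at_set0_boundary r (v : 'rV[S]_r) : const_part v = 0 ->
  exists w, forall A, at_set0 v A = pkoszul w A.
Proof.
move=> v0; apply: pkoszul_exact => [A|k]; first exact: pkoszul_at_set0.
by rewrite /at_set0 eqxx; move/rowP/(_ k): v0; rewrite !mxE.
Qed.

Lemma homogeneous_at_set0 i j (w : 'rV[K]_(rk F i)) :
  (w <= chainsK F i j)%MS ->
  homogeneous (@shift _ _ F i) 0 j (at_set0 (const_lift w)).
Proof.
move/chainsKP=> hw; apply/homogeneousP => A k m; rewrite /at_set0.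
case: (eqVneq A set0) => [->|_]; last by rewrite mxE mcoeff0 eqxx.
rewrite mxE mcoeffC; case: (eqVneq m 0%MM) => [->|_]; last by rewrite mulr0n mulr0 eqxx.
by rewrite mulr1n mulr1 cards0 mdeg0 addn0 => /hw.
Qed.

Lemma boundaries_sub_cycles i j : (boundariesK F i j <= cyclesK F i j)%MS.
Proof.
have sub_chains : (boundariesK F i j <= chainsK F i j)%MS.
  apply/row_subP => k; apply/chainsKP => l.
  rewrite /boundariesK mul_diag_mx !mxE.
  case: (eqVneq (shift k) j) => [sk|_]; last first.
    by rewrite mulr0n mul0r eqxx.
  rewrite mulr1n mul1r => h; have := @diff_homog _ k l 0%MM.
  by rewrite mcoeff_msupp mdeg0 add0n sk => ->.
case: i sub_chains => [|i] //= sub_chains.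
rewrite sub_capmx sub_chains; apply/sub_kermxP.
rewrite /boundariesK -mulmxA -[X in _ *m X](_ : 0 = _) ?mulmx0 //.
rewrite /diffK -map_mxM; apply/matrixP=> k l; rewrite !mxE.
have /rowP/(_ l) := diff_diff (delta_mx 0 k).
rewrite -mulmxA -rowE !mxE => ->.
by rewrite rmorph0.
Qed.

(** Exactness, at Koszul degree i, of the part of multidegree u of the Koszul
    complex of S/I. The sets A with P (u - mesym1 A) index a basis of it; they are
    stable under adding elements of the support of u, so that this is a quotient
    of the strand of S. *)
Definition strand_exact u i := forall c : {set 'I_n} -> K^o,
  (forall A, A \subset vsupp u -> P (u - mesym1 A)%MM -> #|A|.+1 = i ->
     strand u c A = 0) ->
  exists g, forall A, A \subset vsupp u -> P (u - mesym1 A)%MM -> #|A| = i ->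
     c A = strand u g A.

Lemma koszul_exact_of_strands i j z :
  (forall u, mdeg u = j -> strand_exact u i) ->
  homogeneous unshifted i j z -> koszul_cycle z -> exists y, eq_mod_ideal z (pkoszul y).
Proof.
move=> ex_ij /homogeneousP hz cz.
have [u k|y yE] := @pkoszul_lift K n P 1 z; last first.
  by exists y => A m; apply: yE.
rewrite (ord1 k).
have c0 A : strand_coef u 0 z A != 0 -> #|A| = i /\ mdeg u = j.
  rewrite /strand_coef; case: ifP => [sA /hz[cA]|_]; last by rewrite eqxx.
  rewrite /unshifted addn0 -cA -[X in (_ + X)%N](mdeg_mesym1 A) -mdegD submK //.
  exact: mesym1_le.
case: (eqVneq (mdeg u) j) => [uj|uj]; last first.
  exists (fun=> 0) => A _ _.
  rewrite /strand /koszul big1 => [|v _]; last by rewrite scaler0.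
  by apply: contraNeq uj => /c0[_ ->].
have [A sA PA cA|g gE] := ex_ij u uj (strand_coef u 0 z).
  by rewrite -strand_coefE // cz // mxE mcoeff0.
(* truncated to Koszul degree i.+1, so that its boundary vanishes in the other
   degrees, as z does *)
exists (fun A => if #|A| == i.+1 then g A else 0) => A sA PA.
case: (eqVneq #|A| i) => cA.
  rewrite gE //; apply: koszul_ext => v vA.
  by rewrite cardsU1 vA cA eqxx.
rewrite /strand /koszul big1 => [|v vA].
  by apply: contraNeq cA => /c0[-> _].
by rewrite cardsU1 vA eqSS (negbTE cA) scaler0.
Qed.

(** A cycle of F tensored with K lifts to constants in F, goes down to a Koszul
    cycle of S/I, which bounds by exactness of the strands; going back up, the
    cycle is a boundary. *)
Lemma betti_eq0_of_strands i j :
  (forall u, mdeg u = j -> strand_exact u i) -> betti F i j = 0%N.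
Proof.
move=> ex_ij; apply/eqP; rewrite subn_eq0; apply: mxrankS.
apply/row_subP => l; set w := row l _.
have wZ : (w <= cyclesK F i j)%MS by apply: row_sub.
clearbody w.
have wC : (w <= chainsK F i j)%MS.
  by case: i {ex_ij} w wZ {l} => //= i w; rewrite sub_capmx => /andP[].
have liftw : koszul_liftable (at_set0 (const_lift w)).
  case: i {ex_ij} w {wC} wZ {l} => //= i w.
  rewrite sub_capmx => /andP[_ /sub_kermxP wd].
  have [|x' x'E] := @at_set0_boundary _ (const_lift w *m diff F i).
    by rewrite const_part_mul const_partK.
  exists x' => A; rewrite -x'E /at_set0; case: eqP => // _.
  by rewrite mul0mx.
have [|z [hz cz xz]] := zigzag_to_koszul (homogeneous_at_set0 wC) _ liftw.
  by exists (fun=> 0) => A; rewrite mul0mx pkoszul_at_set0.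
rewrite add0n in hz.
have [y zy] := koszul_exact_of_strands ex_ij hz cz.
have [w1 [w2 xE]] := zigzag_boundary xz zy.
(* only the part of degree j of the bounding chain matters *)
pose b := part (@shift _ _ F i.+1) 0 j w2.
have hb : homogeneous (@shift _ _ F i.+1) 0 j b by apply: part_homogeneous.
have wE : w = const_part (b set0) *m diffK F i.
  rewrite -const_part_mul (@part_mul _ _ _ _ _ (@shift _ _ F i)) //.
  have -> : part (@shift _ _ F i) 0 j (fun A => w2 A *m diff F i) set0 =
      part (@shift _ _ F i) 0 j (fun A => at_set0 (const_lift w) A - pkoszul w1 A) set0.
    by apply: part_ext; rewrite xE addrC addKr.
  apply/rowP=> k; rewrite mxE mcoeff_part cards0 eqxx mdeg0 add0n addn0 /=.
  rewrite mxE [X in _ + X]mxE mcoeffB mcoeff0_pkoszul subr0 /at_set0 eqxx.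
  rewrite mxE mpolyCK; case: eqP => // sk.
  by apply/eqP/negPn; apply: contra_notN sk; move/chainsKP: wC; apply.
rewrite wE /boundariesK.
have /submxP[v ->] := chainsK_homogeneous hb.
by rewrite -mulmxA submxMl.
Qed.

Lemma zigzag_cyclesK i j (x : M (rk F i)) z : zigzag x z ->
  (const_part (x set0) <= chainsK F i j)%MS ->
  (const_part (x set0) <= cyclesK F i j)%MS.
Proof.
case: i x => [|i] //= x; case=> x' [_ xx' _] wC; rewrite sub_capmx wC.
by apply/sub_kermxP; rewrite -const_part_mul xx' const_part_pkoszul.
Qed.

(** A cycle of the strand is homogeneous of degree mdeg u, so it climbs to an
    element of F of that degree, whose constant term is a cycle of F tensored with
    K; if that one bounds, so does the strand cycle. *)
Lemma strand_exact_of_betti u i : betti F i (mdeg u) = 0%N -> strand_exact u i.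
Proof.
set j := mdeg u => b0 c cZ.
pose z : M 1 := fun A => if (#|A| == i) && (A \subset vsupp u)
  then const_mx (c A *: 'X_[u - mesym1 A]) else 0.
have coefz A : #|A| = i -> A \subset vsupp u -> strand_coef u 0 z A = c A.
  move=> cA sA; rewrite /strand_coef sA /z cA eqxx sA mxE mcoeffZ mcoeffX eqxx.
  by rewrite mulr1.
have zP A m : (z A 0 0)@_m != 0 ->
    [/\ #|A| = i, A \subset vsupp u & (m + mesym1 A)%MM = u].
  rewrite /z; case: ifP => [/andP[/eqP cA sA]|_]; last by rewrite mxE mcoeff0 eqxx.
  rewrite mxE mcoeffZ mcoeffX; case: (eqVneq _ m) => [<- _|_];
    last by rewrite mulr0n mulr0 eqxx.
  by split=> //; rewrite submK // mesym1_le.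
have hz : homogeneous unshifted i j z.
  apply/homogeneousP => A k m; rewrite (ord1 k) => /zP[cA _ uE].
  by split=> //; rewrite /j -uE mdegD mdeg_mesym1 cA /unshifted addn0.
have cz : koszul_cycle z.
  move=> A m Pm; rewrite [in RHS]mxE mcoeff0.
  case: (boolP ((#|A|.+1 == i) && (m + mesym1 A == u)%MM)) =>
    [/andP[/eqP cA /eqP uE]|nz].
    have sA : A \subset vsupp u.
      by apply/subsetP=> v vA; rewrite inE -uE mnmDE mnmE vA addn1.
    have mE : m = (u - mesym1 A)%MM by rewrite -uE addmK.
    rewrite mE strand_coefE // -[RHS](cZ A) -?mE //.
    rewrite /strand [LHS]big_mkcond [RHS]big_mkcond; apply: eq_bigr => v _.
    case: ifP => // vA; case: (boolP (v \in vsupp u)) => vu.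
      by rewrite coefz ?cardsU1 ?vA // subUset sub1set vu.
    by rewrite mulr0n mulr0 !scale0r.
  rewrite mcoeff_pkoszul big1 // => v vA; case: ifP => mv; last by rewrite mulr0.
  case: (eqVneq (z (v |: A) 0 0)@_(m - U_(v)) 0) => [->|/zP[cA _ uE]].
    by rewrite mulr0.
  case/negP: nz; rewrite -cA cardsU1 vA add1n eqxx -uE /=; apply/eqP/mnmP=> x.
  rewrite !mnmE !inE; case: (eqVneq v x) => [<-|_]; last by rewrite subn0.
  by rewrite (negbTE vA) /= addn0 subnK // lt0n.
have [x hx xz] := @zigzag_of_koszul i 0 j z hz cz.
have wC := chainsK_homogeneous hx; set w := const_part _ in wC.
have wZ : (w <= cyclesK F i j)%MS := zigzag_cyclesK xz wC.
have /submxP[v wE] : (w <= boundariesK F i j)%MS.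
  apply: submx_trans wZ _.
  rewrite -(mxrank_leqif_sup (boundaries_sub_cycles i j)) eqn_leq.
  by rewrite mxrankS ?boundaries_sub_cycles //= -subn_eq0; apply/eqP.
pose b := at_set0 (const_lift (v *m chainsK F i.+1 j)).
have [|w1 w1E] := @at_set0_boundary _ (x set0 - b set0 *m diff F i).
  have -> : const_part (x set0 - b set0 *m diff F i)
      = const_part (x set0) - const_part (b set0 *m diff F i) by apply: map_mxB.
  rewrite const_part_mul /b /at_set0 eqxx const_partK -/w wE /boundariesK.
  by rewrite mulmxA subrr.
have [|y zy] := @zigzag_boundary_inv i x z w1 b xz.
  move=> A; rewrite -w1E /b /at_set0; case: eqP => [->|/eqP A0].
    by rewrite eqxx subrK.
  by rewrite mul0mx addr0 (homogeneous_card hx) // cards_eq0.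
exists (strand_coef u 0 y) => A sA PA cA.
by rewrite -strand_coefE // -zy // -(coefz A cA sA) /strand_coef sA.
Qed.

End MonomialIdeal.

(** * Edge ideals *)

Section EdgeIdeal.
Variables (K : fieldType) (n : nat) (G : rel 'I_n).
Hypotheses (G_sym : ssrbool.symmetric G) (G_irr : irreflexive G).
Notation S := {mpoly K[n]}.
Implicit Types (m u : 'X_{1..n}) (A W : {set 'I_n}).

Definition indep_mnm m := independent G (vsupp m).

Lemma indep_mnm_down m1 m2 : indep_mnm (m1 + m2)%MM -> indep_mnm m2.
Proof.
apply: independentS; apply/subsetP=> v; rewrite !inE mnmDE addn_eq0.
by apply: contraNN => /andP[].
Qed.

Lemma edge_idealD p q :
  edge_ideal K G p -> edge_ideal K G q -> edge_ideal K G (p + q).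
Proof.
case=> c -> [d ->]; exists (fun i j => c i j + d i j).
rewrite -big_split; apply: eq_bigr => i _; rewrite -big_split.
by apply: eq_bigr => j _; rewrite mulrDl.
Qed.

Lemma edge_ideal_monomial (p : S) :
  edge_ideal K G p <-> forall m, indep_mnm m -> p@_m = 0.
Proof.
split=> [[c ->] m mI|h].
  rewrite raddf_sum big1 // => i _; rewrite raddf_sum big1 // => j Gij /=.
  have ij : i != j by apply: contraTneq Gij => ->; rewrite G_irr.
  rewrite mulrC -mulrA !mcoeff_XM; case: ifP => // mi; case: ifP => // mj.
  have := independentP _ _ mI i j; rewrite !inE mi Gij => /(_ isT).
  by move: mj; rewrite mnmBE mnm1E (negbTE ij) subn0 => -> /(_ isT).
have I0 : edge_ideal K G (0 : S).
  exists (fun _ _ => 0); rewrite big1 // => i _; rewrite big1 // => j _.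
  by rewrite mul0r.
rewrite [p]mpolyE; elim/big_ind: _ => [||m _]; [exact: I0|exact: edge_idealD|].
case: (boolP (indep_mnm m)) => [/h->|]; first by rewrite scale0r.
case/forall_inPn => i iM /forall_inPn[j jM /negPn Gij].
have ij : i != j by apply: contraTneq Gij => ->; rewrite G_irr.
exists (fun i' j' => if (i' == i) && (j' == j)
  then p@_m *: 'X_[m - (U_(i) + U_(j))] else 0).
rewrite (bigD1 i) //= [X in _ + X]big1 => [|i' /negbTE i'i]; last first.
  by rewrite big1 // => j' _; rewrite i'i mul0r.
rewrite (bigD1 j) //= [X in _ + X + _]big1 => [|j' /andP[_ /negbTE j'j]]; last first.
  by rewrite j'j andbF mul0r.
rewrite !eqxx !addr0 -scalerAl -!mpolyXD submK //.
apply/mnm_lepP=> v; rewrite mnmDE !mnm1E.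
move: iM jM; rewrite !inE.
case: (eqVneq i v) => [<-|_]; last by case: (eqVneq j v) => [<-|//]; rewrite lt0n.
by rewrite [j == i]eq_sym (negbTE ij) addn0 lt0n.
Qed.

(** When w divides the monomial u twice, adding or removing w in A does not change
    the support of u - A, so toggling w contracts the strand. *)
Lemma strand_exact_nonsquarefree u w i : (1 < u w)%N ->
  strand_exact K indep_mnm u i.
Proof.
move=> uw c cZ; exists (toggle w c) => A sA PA cA.
have wu : w \in vsupp u by rewrite inE -lt0n ltnW.
rewrite [LHS](strand_homotopy _ _ wu) /toggle; case: ifP => wA; last by rewrite addr0.
rewrite cZ ?scaler0 ?addr0 //.
- exact: subset_trans (subsetDl _ _) sA.
- move: PA; rewrite /indep_mnm.
  suff -> : vsupp (u - mesym1 A) = vsupp (u - mesym1 (A :\ w)) by [].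
  apply/setP=> v; rewrite !inE !mnmBE !mnmE !inE; case: (eqVneq v w) => //= ->.
  by rewrite wA subn0 -!lt0n subn_gt0 uw ltnW.
- by rewrite -cA (cardsD1 w A) wA.
Qed.

Lemma vsupp_mesym1B W A : vsupp (mesym1 W - mesym1 A) = W :\: A.
Proof.
apply/setP=> v; rewrite !inE mnmBE !mnmE.
by case: (v \in W); case: (v \in A).
Qed.

(** Passing from A to its complement in W changes the sign of the Koszul
    differential by a factor that only depends on v and W; the twist absorbs it. *)
Definition twist W A : K := \prod_(v in A) (-1) ^+ inv_parity v W.

Lemma twistK W A : twist W A * twist W A = 1.
Proof.
rewrite -big_split big1 //= => v _.
by rewrite -signr_addb addbb.
Qed.

Lemma inv_parityD v A W : A \subset W ->
  inv_parity v A = inv_parity v W (+) inv_parity v (W :\: A).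
Proof.
move=> sA; rewrite /inv_parity.
have -> : [set u in W :\: A | (u < v)%N]
    = [set u in W | (u < v)%N] :\: [set u in A | (u < v)%N].
  apply/setP=> u; rewrite !inE; case: (_ < v)%N; rewrite ?andbF //= ?andbT //.
have sAW : [set u in A | (u < v)%N] \subset [set u in W | (u < v)%N].
  apply/subsetP=> u; rewrite !inE => /andP[/(subsetP sA)-> ->] //.
rewrite -[in RHS](subnKC (subset_leq_card sAW)) oddD cardsD (setIidPr sAW).
by rewrite -addbA addbb addbF.
Qed.

(** The squarefree strands are the cochain complexes of independence complexes;
    the faces are the complements of the exterior monomials. *)
Lemma strand_coboundary W (c : {set 'I_n} -> K^o) (f : {set 'I_n} -> K) A :
  (forall B : {set 'I_n}, B \subset W -> c B = twist W B * f (W :\: B)) ->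
  A \subset W ->
  strand (mesym1 W) c A = twist W A * coboundary f (W :\: A).
Proof.
move=> cf sA; rewrite /strand /koszul /coboundary mulr_sumr.
rewrite vsupp_mesym1.
rewrite big_mkcond [RHS]big_mkcond; apply: eq_bigr => v _.
rewrite inE; case: ifP => //= vA; case: ifP => vW; last by rewrite mulr0 scale0r.
rewrite mulr1 cf ?subUset ?sub1set ?vW //.
have -> : W :\: (v |: A) = (W :\: A) :\ v.
  by rewrite setDDl setUC.
rewrite /twist big_setU1 ?vA //= (inv_parityD v sA) signr_addb.
set a := _ ^+ inv_parity v W; have aa : a * a = 1 by rewrite -signr_addb addbb.
rewrite -[RHS]mul1r -aa -[LHS]/(_ * _); ring.
Qed.

Lemma strand_exact_squarefree W i e : #|W| = (i + e)%N ->
  strand_exact K indep_mnm (mesym1 W) i <-> acyclic K G e W.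
Proof.
move=> cW.
have vW := vsupp_mesym1 W.
have DD (B : {set 'I_n}) : B \subset W -> W :\: (W :\: B) = B.
  by move=> sB; rewrite setDDr setDv set0U; apply/setIidPr.
have cD (B : {set 'I_n}) : B \subset W -> (#|B| + #|W :\: B| = i + e)%N.
  by move=> sB; rewrite cardsD (setIidPr sB) subnKC ?subset_leq_card.
split=> h.
- move=> f fZ.
  pose c (B : {set 'I_n}) : K^o := twist W B * f (W :\: B).
  have [|g gE] := h c.
    rewrite vW => A sA; rewrite /indep_mnm vsupp_mesym1B => iA cA.
    rewrite (@strand_coboundary _ _ f) // fZ ?mulr0 // ?subsetDl //.
    by have := cD _ sA; lia.
  pose g' (B : {set 'I_n}) := twist W (W :\: B) * g (W :\: B).
  have gg' (B : {set 'I_n}) : B \subset W -> g B = twist W B * g' (W :\: B).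
    by move=> sB; rewrite /g' DD // mulrA twistK mul1r.
  exists g' => B sB iB cB.
  have sD : W :\: B \subset W by apply: subsetDl.
  have := gE (W :\: B); rewrite vW /indep_mnm vsupp_mesym1B DD // => /(_ sD iB).
  have -> : #|W :\: B| = i by have := cD _ sB; lia.
  move=> /(_ erefl); rewrite (strand_coboundary gg') // /c DD //.
  by move/(congr1 ( *%R (twist W (W :\: B)))); rewrite !mulrA twistK !mul1r.
- move=> c cZ.
  pose f (B : {set 'I_n}) := twist W (W :\: B) * c (W :\: B).
  have cf (B : {set 'I_n}) : B \subset W -> c B = twist W B * f (W :\: B).
    by move=> sB; rewrite /f DD // mulrA twistK mul1r.
  have [|g gE] := h f.
    move=> B sB iB cB; have sD : W :\: B \subset W by apply: subsetDl.
    have := cZ (W :\: B); rewrite vW /indep_mnm vsupp_mesym1B DD // => /(_ sD iB).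
    have -> : #|W :\: B|.+1 = i by have := cD _ sB; lia.
    move=> /(_ erefl); rewrite (strand_coboundary cf) // DD //.
    by move/(congr1 ( *%R (twist W (W :\: B)))); rewrite mulrA twistK mul1r mulr0.
  pose g' (B : {set 'I_n}) : K^o := twist W B * g (W :\: B).
  exists g' => A; rewrite vW => sA; rewrite /indep_mnm vsupp_mesym1B => iA cA.
  rewrite (@strand_coboundary _ _ g) // cf // gE ?subsetDl //.
  by have := cD _ sA; lia.
Qed.

Variable F : graded_free_complex K n.
Hypothesis F_res : graded_free_resolution (edge_ideal K G) F.

(** Hochster's formula, as far as vanishing is concerned. *)
Lemma betti_hochster i j : betti F i j <> 0%N <-> hochster_nonzero K G i j.
Proof.
split=> [nb|[W [e [cW ie nA]]] b0]; last first.
  apply: nA; apply/(@strand_exact_squarefree _ i); first by rewrite cW ie.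
  apply: (strand_exact_of_betti indep_mnm_down edge_ideal_monomial F_res).
  by rewrite mdeg_mesym1 cW.
apply: NNPP => nH; apply: nb.
apply: (betti_eq0_of_strands indep_mnm_down edge_ideal_monomial F_res) => u uj.
case: (boolP [exists w, (1 < u w)%N]) => [/existsP[w uw]|/existsPn usf].
  exact: strand_exact_nonsquarefree uw.
have uE : u = mesym1 (vsupp u).
  apply/mnmP=> v; rewrite mnmE inE; have := usf v; rewrite -leqNgt.
  by case: (u v) => [|[|]].
have cW : #|vsupp u| = j by rewrite -mdeg_mesym1 -uE.
case: (leqP i j) => ij; last first.
  move=> c _; exists (fun=> 0) => A sA _ cA.
  by have := subset_leq_card sA; rewrite cW cA leqNgt ij.
rewrite uE; apply/(@strand_exact_squarefree _ _ (j - i)); first by rewrite subnKC.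
apply: NNPP => nA; apply: nH.
by exists (vsupp u), (j - i)%N; rewrite subnKC.
Qed.

(** A degree in which Tor does not vanish is a shift of F, since otherwise F
    tensored with K has no chains in that degree. *)
Lemma max_shift_hochster i j : hochster_nonzero K G i j -> (j <= max_shift F i)%N.
Proof.
move/betti_hochster/eqP => b0.
have [k kj] : exists k : 'I_(rk F i), shift k = j.
  apply: NNPP => nk; move: b0; rewrite /betti.
  have -> : \rank (cyclesK F i j) = 0%N; last by rewrite sub0n.
  apply/eqP; rewrite mxrank_eq0 -submx0.
  have <- : chainsK F i j = 0.
    apply/matrixP=> k l; rewrite !mxE; case: (eqVneq (shift k) j) => [kj|_].
      by case: nk; exists k.
    by rewrite mul0rn.
  by case: (i) => [|i'] //=; rewrite capmxSl.
by rewrite -kj; apply: leq_bigmax_cond; rewrite kj.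
Qed.

Lemma max_shift_attained i : max_shift F i != 0%N ->
  hochster_nonzero K G i (max_shift F i).
Proof.
rewrite /max_shift => ms0.
have [k0 k0b] : exists k : 'I_(rk F i), betti F i (shift k) != 0%N.
  apply: NNPP => nk; case/negP: ms0; rewrite big1 // => k kb.
  by case: nk; exists k.
have [k kb ->] := @eq_bigmax_cond _ (fun k => betti F i (shift k) != 0%N)
  (@shift _ _ F i) (introT card_gt0P (ex_intro _ k0 k0b)).
by apply/betti_hochster/eqP.
Qed.

End EdgeIdeal.

Local Close Scope ring_scope.

Theorem theorem3p3 (K : fieldType) (n : nat) (G : rel 'I_n)
    (G_sym : ssrbool.symmetric G) (G_irr : irreflexive G)
    (F : graded_free_complex K n)
    (F_res : graded_free_resolution (edge_ideal K G) F)
    (b : nat) (b_le_pd : le_pd b (edge_ideal K G))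
    (t_b_ge : uphalf (3 * b) <= max_shift F b)
    (a : nat) (ab_le_pd : le_pd (a + b) (edge_ideal K G)) :
  max_shift F (a + b) <= max_shift F a + max_shift F b.
Proof.
case: (eqVneq (max_shift F (a + b)) 0%N) => [->//|ne0].
have hab := max_shift_attained G_irr F_res ne0.
have le_t := max_shift_hochster G_irr F_res.
case: (hochster_descent G_sym G_irr hab) => [hm|[j hj lj]].
  (* an induced matching of a edges: t_a is at least 2 a *)
  have [j hj lj] := hochster_sub G_sym G_irr hab.
  by have := le_t _ _ hm; have := le_t _ _ hj; lia.
by have := le_t _ _ hj; lia.
Qed.
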